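(* The sylvester monoid satisfies the identity $xyxy = yxxy$; that is, for all $x,y \in \mathcal{A}^*$, $xyxy \equiv_{\mathrm{sylv}} yxxy$.
   Context: $\mathcal{A} = \{1,2,3,\ldots\}$ with the usual order; $\mathcal{A}^*$ the free monoid over $\mathcal{A}$. A right strict binary search tree is a labelled rooted binary tree where each node's label is $\ge$ all labels in its left subtree and $<$ all labels in its right subtree. $\mathrm{rtree}(a_1\cdots a_k)$ is obtained from the empty tree by inserting $a_k,\ldots,a_1$ in turn, where inserting $a$ creates a node labelled $a$ if the tree is empty and otherwise recurses into the left subtree if $a \le$ root label and into the right subtree otherwise. The sylvester congruence is $u \equiv_{\mathrm{sylv}} v$ iff $\mathrm{rtree}(u) = \mathrm{rtree}(v)$, and the sylvester monoid is $\mathcal{A}^*/{\equiv_{\mathrm{sylv}}}$. (Equivalently, $\equiv_{\mathrm{sylv}}$ is the congruence generated by $cavb \equiv acvb$ for $a \le b < c$, $v \in \mathcal{A}^*$.) *)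

(* Defs.v *)
From HB Require Import structures.
From mathcomp Require Import all_boot.

Set Implicit Arguments.
Unset Strict Implicit.
Unset Printing Implicit Defensive.

Local Open Scope quotient_scope.

Definition letter := {n : nat | 0 < n}.
Definition word := seq letter.

Inductive tree := Empty | Node of tree & letter & tree.

Fixpoint encode_tree (t : tree) : GenTree.tree letter :=
  if t is Node l b r then
    GenTree.Node 0 [:: encode_tree l; GenTree.Leaf b; encode_tree r]
  else GenTree.Node 0 [::].

Fixpoint decode_tree (t : GenTree.tree letter) : option tree :=
  match t with
  | GenTree.Node _ [::] => Some Empty
  | GenTree.Node _ [:: l; GenTree.Leaf b; r] =>
      if (decode_tree l, decode_tree r) is (Some l', Some r')
      then Some (Node l' b r') else None
  | _ => None
  end.

Lemma encode_treeK : pcancel encode_tree decode_tree.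
Proof. by elim=> [|l IHl b r IHr] //=; rewrite IHl IHr. Qed.

HB.instance Definition _ := Equality.copy tree (pcan_type encode_treeK).

Fixpoint insert (a : letter) (t : tree) : tree :=
  if t is Node l b r then
    if val a <= val b then Node (insert a l) b r else Node l b (insert a r)
  else Node Empty a Empty.

(* foldr inserts the letters of a word from the last one to the first one. *)
Definition rtree (u : word) : tree := foldr insert Empty u.

Definition sylv : rel word := fun u v => rtree u == rtree v.

Lemma sylv_refl : reflexive sylv.
Proof. by move=> u; apply: eqxx. Qed.

Lemma sylv_sym : symmetric sylv.
Proof. by move=> u v; apply: eq_sym. Qed.

Lemma sylv_trans : transitive sylv.
Proof. by move=> v u w /eqP uv /eqP vw; apply/eqP; rewrite uv. Qed.

Canonical sylv_equiv := EquivRel sylv sylv_refl sylv_sym sylv_trans.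

Lemma foldr_insert_Node (u : word) l b r :
  foldr insert (Node l b r) u =
  Node (foldr insert l [seq a <- u | val a <= val b]) b
       (foldr insert r [seq a <- u | val b < val a]).
Proof. by elim: u => //= a u ->; rewrite ltnNge /=; case: leqP. Qed.

Fixpoint tree_le (n : nat) (t : tree) : tree :=
  if t is Node l b r then
    if val b <= n then Node l b (tree_le n r) else tree_le n l
  else Empty.

Fixpoint tree_gt (n : nat) (t : tree) : tree :=
  if t is Node l b r then
    if val b <= n then tree_gt n r else Node (tree_gt n l) b r
  else Empty.

Lemma tree_le_insert n a t :
  tree_le n (insert a t) = if val a <= n then insert a (tree_le n t)
                           else tree_le n t.
Proof.
elim: t => [|l IHl b r IHr] /=; first by case: ifP.
case: (leqP (val a) (val b)) => /= ab; case: (leqP (val b) n) => /= bn //.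
- by rewrite (leq_trans ab bn) ab.
- by rewrite IHr /= (leqNgt (val a) (val b)) ab /=; case: ifP.
- by rewrite leqNgt (ltn_trans bn ab).
Qed.

Lemma tree_gt_insert n a t :
  tree_gt n (insert a t) = if val a <= n then tree_gt n t
                           else insert a (tree_gt n t).
Proof.
elim: t => [|l IHl b r IHr] /=; first by case: ifP.
case: (leqP (val a) (val b)) => /= ab; case: (leqP (val b) n) => /= bn //.
- by rewrite (leq_trans ab bn).
- by rewrite IHl ab; case: ifP.
- by rewrite leqNgt (ltn_trans bn ab) /= (leqNgt (val a) (val b)) ab.
Qed.

Lemma rtree_filter_le n (u : word) :
  rtree [seq a <- u | val a <= n] = tree_le n (rtree u).
Proof.
by elim: u => //= a u IHu; rewrite tree_le_insert -IHu; case: ifP.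
Qed.

Lemma rtree_filter_gt n (u : word) :
  rtree [seq a <- u | n < val a] = tree_gt n (rtree u).
Proof.
by elim: u => //= a u IHu; rewrite tree_gt_insert -IHu ltnNge; case: (val a <= n).
Qed.

Lemma sylv_foldr (u v : word) t :
  rtree u = rtree v -> foldr insert t u = foldr insert t v.
Proof.
elim: t u v => [|l IHl b r IHr] u v uv //.
rewrite !foldr_insert_Node (IHl _ [seq a <- v | val a <= val b])
        ?(IHr _ [seq a <- v | val b < val a]) //.
  by rewrite !rtree_filter_gt uv.
by rewrite !rtree_filter_le uv.
Qed.

Lemma sylv_cat (u u' v v' : word) :
  sylv u u' -> sylv v v' -> sylv (u ++ v) (u' ++ v').
Proof.
move=> /eqP uu' /eqP; rewrite /sylv /rtree !foldr_cat => ->.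
by apply/eqP/sylv_foldr.
Qed.

Definition sylvester := {eq_quot sylv}.
HB.instance Definition _ := Choice.on sylvester.

Definition sylv_class (u : word) : sylvester := \pi_sylvester u.

Definition sylv_one : sylvester := sylv_class [::].
Definition sylv_mul (p q : sylvester) : sylvester :=
  sylv_class (repr p ++ repr q).

Lemma sylv_classP (u v : word) : sylv_class u = sylv_class v <-> sylv u v.
Proof. by split=> [/eqmodP|uv] //; apply/eqmodP. Qed.

(* The product is induced by concatenation of words. *)
Lemma sylv_mulE (u v : word) :
  sylv_mul (sylv_class u) (sylv_class v) = sylv_class (u ++ v).
Proof.
by apply/sylv_classP/sylv_cat; apply/sylv_classP; rewrite /sylv_class reprK.
Qed.

Lemma sylv_classW (P : sylvester -> Prop) :
  (forall u, P (sylv_class u)) -> forall p, P p.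
Proof. by move=> Pu p; rewrite -[p]reprK; apply: Pu. Qed.

Lemma sylv_mulA : associative sylv_mul.
Proof.
elim/sylv_classW=> u; elim/sylv_classW=> v; elim/sylv_classW=> w.
by rewrite !sylv_mulE catA.
Qed.

Lemma sylv_mul1w : left_id sylv_one sylv_mul.
Proof. by elim/sylv_classW=> u; rewrite sylv_mulE. Qed.

Lemma sylv_mulw1 : right_id sylv_one sylv_mul.
Proof. by elim/sylv_classW=> u; rewrite sylv_mulE cats0. Qed.

HB.instance Definition _ :=
  isMonoid.Build sylvester sylv_mulA sylv_mul1w sylv_mulw1.

(* Main.v *)
(** Letters inserted into a binary search tree can only interact when they
    follow the same path from the root. If the tree already contains all the
    letters to be inserted, two different letters are separated by some node,
    so only equal letters meet in the same empty subtree and the order of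
    insertion is irrelevant. Since [xyxy] and [yxxy] have the common suffix
    [xy], which contains every letter of [xy] and of [yx], the two words have
    the same tree. *)
Require Import Defs.
From mathcomp Require Import all_boot.

(** Equality is allowed on the left only: [insert] goes left on ties, so a node [b] sends [a] left
    and [c] right. *)
Definition separates (w u : word) : Prop :=
  {in u &, forall a c, val a < val c ->
    exists2 b, b \in w & val a <= val b < val c}.

Lemma rtree_cat_rcons (u w : word) b :
  rtree (u ++ rcons w b) =
  Node (rtree [seq a <- u ++ w | val a <= val b]) b
       (rtree [seq a <- u ++ w | val b < val a]).
Proof. by rewrite -rcons_cat /rtree foldr_rcons foldr_insert_Node. Qed.

Lemma perm_constant_eq (T : eqType) (s t : seq T) :
  {in s &, forall a b, a = b} -> perm_eq s t -> s = t.
Proof.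
move=> s_eq st; case: s s_eq st => [_|a s s_eq st].
  by rewrite perm_sym => /perm_nilP.
have s_a : all (pred1 a) (a :: s).
  by apply/allP=> b bs; apply/eqP/s_eq; rewrite ?mem_head.
have t_a : all (pred1 a) t by rewrite -(perm_all _ st).
by rewrite (all_pred1P _ _ s_a) (all_pred1P _ _ t_a) (perm_size st).
Qed.

(** A separator is strictly below the larger letter, hence below [b]: it is not [b] itself and
    survives the filter. *)
Lemma separates_le (w u : word) b :
  separates (rcons w b) u ->
  separates [seq a <- w | val a <= val b] [seq a <- u | val a <= val b].
Proof.
move=> sep a c; rewrite !mem_filter => /andP[_ au] /andP[cb cu] ac.
have [d] := sep a c au cu ac.
rewrite mem_rcons inE => /predU1P[-> /andP[_]|dw /andP[ad dc]].
  by rewrite ltnNge cb.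
by exists d; rewrite ?ad ?mem_filter // dw (leq_trans (ltnW dc) cb).
Qed.

Lemma separates_gt (w u : word) b :
  separates (rcons w b) u ->
  separates [seq a <- w | val b < val a] [seq a <- u | val b < val a].
Proof.
move=> sep a c; rewrite !mem_filter => /andP[ba au] /andP[_ cu] ac.
have [d] := sep a c au cu ac.
rewrite mem_rcons inE => /predU1P[-> /andP[]|dw /andP[ad dc]].
  by rewrite leqNgt ba.
by exists d; rewrite ?ad ?mem_filter // dw (leq_trans ba ad).
Qed.

(** Induction on the size of [w]: its last letter is the root, and both subtrees come from filtered
    words. *)
Lemma rtree_perm_cat (w u v : word) :
  separates w u -> perm_eq u v -> rtree (u ++ w) = rtree (v ++ w).
Proof.
have [n] := ubnP (size w); elim: n w u v => // n IHn w u v.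
case/lastP: w => [_ sep uv|w b].
  (* An empty [w] has no separators, so all letters of [u] are equal. *)
  congr (rtree (_ ++ _)); apply: perm_constant_eq uv => a c au cu.
  apply: val_inj; apply/eqP.
  by case: ltngtP => // [/(sep _ _ au cu)|/(sep _ _ cu au)] [].
rewrite size_rcons ltnS => w_lt sep uv.
rewrite !rtree_cat_rcons !filter_cat; congr (Node _ _ _); apply: IHn.
- by rewrite size_filter (leq_ltn_trans (count_size _ _)).
- exact: separates_le.
- exact: perm_filter.
- by rewrite size_filter (leq_ltn_trans (count_size _ _)).
- exact: separates_gt.
- exact: perm_filter.
Qed.

(** The smaller letter [a] serves as the separator. *)
Lemma separates_subset (w u : word) : {subset u <= w} -> separates w u.
Proof. by move=> uw a c au _ ac; exists a; rewrite ?leqnn // uw. Qed.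

Theorem theorem4 :
  (forall p q : sylvester, (p * q * p * q)%g = (q * p * p * q)%g) /\
  (forall x y : word, sylv (x ++ y ++ x ++ y) (y ++ x ++ x ++ y)).
Proof.
have sylv_xyxy x y : sylv (x ++ y ++ x ++ y) (y ++ x ++ x ++ y).
  rewrite catA [in X in sylv _ X]catA; apply/eqP/rtree_perm_cat.
    exact: separates_subset.
  exact: permEl (perm_catC x y).
split=> //; elim/sylv_classW=> x; elim/sylv_classW=> y.
have mulE u v : (sylv_class u * sylv_class v)%g = sylv_class (u ++ v).
  exact: sylv_mulE.
by rewrite !mulE -!catA; apply/sylv_classP.
Qed.
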